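(* Consider the stochastic process (case 1) describing transmission of photons through a sequence of $M\ge 1$ polarization sensitive elements rotated by angles $\vec\alpha=(\alpha_0,\dots,\alpha_{M-1})$, with $N_0\neq 0$ initial photons, as defined in the context. Then for every $i\in(0,\dots,M-1)$, $$\frac{N_{i+1}(\vec\alpha)}{N_0}\,\rho_{S,i+1}(\theta_{i+1},\vec\alpha)=\int_{\theta_i}\frac{N_i(\vec\alpha)}{N_0}\,\rho_{S,i}(\theta_i,\vec\alpha)\,P_{T,i}(\theta_i,\alpha_i)\,\rho_{C,i}(\theta_i,\theta_{i+1},\alpha_i)\,\mathrm{d}\theta_i .$$
   Context: Process ''case 1''. Photons pass successively through surfaces $\Sigma_0,\dots,\Sigma_M$; the $i$-th polarization sensitive element ($i=0,\dots,M-1$) lies between $\Sigma_i$ and $\Sigma_{i+1}$ and is rotated by a fixed (non-random) angle $\alpha_i$; $\vec\alpha=(\alpha_0,\dots,\alpha_{M-1})$. The state of a photon at $\Sigma_i$ is a random polarization angle $\theta_i$, ranging over a fixed interval of length $2\pi$ with Lebesgue measure $\mathrm{d}\theta_i$; $\int_{\theta_i}$ denotes integration over this interval. $N_0>0$ photons pass through $\Sigma_0$; different photons are independent. The data are: - $\rho_{S,0}(\theta_0,\vec\alpha)$: the probability density of $\theta_0$ (it does not depend on the element rotations). - $P_{T,i}(\theta_i,\alpha_i)\in[0,1]$, measurable: the conditional probability that a photon with polarization angle $\theta_i$ at $\Sigma_i$ is transmitted through the $i$-th element (otherwise it never reaches $\Sigma_{i+1},\dots,\Sigma_M$). - $\rho_{C,i}(\theta_i,\theta_{i+1},\alpha_i)\ge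 0$, jointly measurable in $(\theta_i,\theta_{i+1})$, with $\int_{\theta_{i+1}}\rho_{C,i}(\theta_i,\theta_{i+1},\alpha_i)\,\mathrm{d}\theta_{i+1}=1$ for all $\theta_i$: the conditional probability density of the outgoing polarization angle $\theta_{i+1}$, given the incoming angle $\theta_i$ and given that the photon was transmitted through the $i$-th element. Memoryless (Markov) property: transmission through the $i$-th element and the resulting angle depend on the past only through $\theta_i$. Derived quantities: $N_i(\vec\alpha)$ is the (expected) number of photons which pass through $\Sigma_i$, i.e. $N_0$ times the probability that a photon reaches $\Sigma_i$ (so $N_0(\vec\alpha)=N_0$); $\rho_{S,i}(\theta_i,\vec\alpha)$ is the probability density of the polarization angle at $\Sigma_i$ conditioned on the photon reaching $\Sigma_i$ (both depend on $\vec\alpha$ at most through $\alpha_0,\dots,\alpha_{i-1}$). If $N_i(\vec\alpha)=0$, the product $N_i(\vec\alpha)\rho_{S,i}(\theta_i,\vec\alpha)$ is understood to be $0$. Identities between densities are understood almost everywhere. *)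

(* Defs.v *)
From HB Require Import structures.
From mathcomp Require Import all_boot all_order all_algebra.
From mathcomp Require Import all_classical all_reals all_analysis.
Set Implicit Arguments.
Unset Strict Implicit.
Unset Printing Implicit Defensive.
Import Order.TTheory GRing.Theory Num.Theory.
Import numFieldNormedType.Exports.
Local Open Scope classical_set_scope.
Local Open Scope ring_scope.

(* The surfaces are indexed by 'I_M.+1 and the elements by 'I_M; element i lies
   between the surfaces Sigma_i and Sigma_(i+1). *)
Definition surf_in (M : nat) (i : 'I_M) : 'I_M.+1 := widen_ord (leqnSn M) i.
Definition surf_out (M : nat) (i : 'I_M) : 'I_M.+1 := lift ord0 i.

(* [angles] is the interval of length 2 pi; its endpoints may be in or out.
   The last argument of [PT] and [rhoC] is the rotation of the element. *)
Record optical_data (R : realType) (M : nat) (angles : interval R)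
    (rhoS0 : R -> R) (PT : 'I_M -> R -> R -> R)
    (rhoC : 'I_M -> R -> R -> R -> R) : Prop := OpticalData {
  angles_length :
    lebesgue_measure [set` angles] = (2 * pi)%:E ;
  rhoS0_meas : measurable_fun [set` angles] rhoS0 ;
  rhoS0_ge0 : forall t, t \in angles -> 0 <= rhoS0 t ;
  rhoS0_mass :
    (\int[lebesgue_measure]_(t in [set` angles]) (rhoS0 t)%:E = 1)%E ;
  PT_meas : forall i a, measurable_fun [set` angles] (fun t => PT i t a) ;
  PT_itv : forall i a t, t \in angles -> 0 <= PT i t a <= 1 ;
  rhoC_meas : forall i a,
    measurable_fun ([set` angles] `*` [set` angles])
      (fun x : R * R => rhoC i x.1 x.2 a) ;
  rhoC_ge0 : forall i a t t',
    t \in angles -> t' \in angles -> 0 <= rhoC i t t' a ;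
  rhoC_mass : forall i a t, t \in angles ->
    (\int[lebesgue_measure]_(t' in [set` angles]) (rhoC i t t' a)%:E = 1)%E
}.

(* [f] is a version, on the event [C], of the conditional probability of [E]
   given [C] and the events of [G].  Below [f] is always a function of the
   current angle, measurable on the interval of angles; this is what makes it
   measurable with respect to [G] on [C]. *)
Definition cond_prob_given d (Omega : measurableType d) (R : realType)
    (P : probability Omega R) (G : set (set Omega)) (C E : set Omega)
    (f : Omega -> \bar R) : Prop :=
  forall H, G H ->
    (P (H `&` C `&` E) = \int[P]_(w in H `&` C) f w)%E.

Definition sigma_of d (Omega : measurableType d) (R : realType)
    (X : Omega -> R) : set (set Omega) :=
  preimage_set_system setT X measurable.

(* Events depending on one photon up to the surface [i].  The angle at a surface
   is only observed when the photon reaches it; with [B := setT] the generators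
   include the events [reach j] themselves. *)
Definition past d (Omega : measurableType d) (R : realType) (M : nat)
    (reach : 'I_M.+1 -> set Omega) (theta : 'I_M.+1 -> Omega -> R)
    (i : 'I_M.+1) : set (set Omega) :=
  <<s [set A | exists (j : 'I_M.+1) (B : set R),
        [/\ (j <= i)%N, measurable B & A = reach j `&` theta j @^-1` B]] >>.

(* The process followed by one photon: [reach i] is the event that it reaches
   the surface [i], and [theta i] is its polarization angle there.  The values of
   [theta i] outside [reach i] are irrelevant. *)
Record photon_process d (Omega : measurableType d) (R : realType)
    (P : probability Omega R) (M : nat) (angles : interval R)
    (rhoS0 : R -> R) (PT : 'I_M -> R -> R -> R)
    (rhoC : 'I_M -> R -> R -> R -> R) (alpha : 'I_M -> R)
    (reach : 'I_M.+1 -> set Omega) (theta : 'I_M.+1 -> Omega -> R) : Prop :=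
  PhotonProcess {
  reach_meas : forall i, measurable (reach i) ;
  theta_meas : forall i, measurable_fun setT (theta i) ;
  theta_angles : forall i w, reach i w -> theta i w \in angles ;
  reach_start : reach ord0 = setT ;
  reach_decr : forall i : 'I_M, reach (surf_out i) `<=` reach (surf_in i) ;
  start_law : forall B : set R, measurable B ->
    (P (theta ord0 @^-1` B) =
     \int[lebesgue_measure]_(t in [set` angles] `&` B) (rhoS0 t)%:E)%E ;
  transmission_law : forall i : 'I_M,
    cond_prob_given P (sigma_of (theta (surf_in i)))
      (reach (surf_in i)) (reach (surf_out i))
      (fun w => (PT i (theta (surf_in i) w) (alpha i))%:E) ;
  outgoing_law : forall (i : 'I_M) (B : set R), measurable B ->
    cond_prob_given P (sigma_of (theta (surf_in i)))
      (reach (surf_out i)) (theta (surf_out i) @^-1` B)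
      (fun w => \int[lebesgue_measure]_(t' in [set` angles] `&` B)
         (rhoC i (theta (surf_in i) w) t' (alpha i))%:E)%E ;
  (* Given the past, the joint law of the transmission and of the outgoing angle
     is a function of the current angle; [B := setT] is the transmission. *)
  memoryless : forall (i : 'I_M) (B : set R), measurable B ->
    exists g : R -> R,
      [/\ measurable_fun [set` angles] g,
          forall t, t \in angles -> 0 <= g t <= 1 &
          cond_prob_given P (past reach theta (surf_in i))
            (reach (surf_in i))
            (reach (surf_out i) `&` theta (surf_out i) @^-1` B)
            (fun w => (g (theta (surf_in i) w))%:E)]
}.

Definition independent_photons d (Omega : measurableType d) (R : realType)
    (P : probability Omega R) (M N0 : nat)
    (reach : 'I_N0 -> 'I_M.+1 -> set Omega)
    (theta : 'I_N0 -> 'I_M.+1 -> Omega -> R) : Prop :=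
  forall (J : {set 'I_N0}) (E : 'I_N0 -> set Omega),
    (forall k, k \in J -> past (reach k) (theta k) ord_max (E k)) ->
    (P (\bigcap_(k in [set` J]) E k) = \prod_(k in J) P (E k))%E.

Definition photon_number d (Omega : measurableType d) (R : realType)
    (P : probability Omega R) (M N0 : nat)
    (reach : 'I_N0 -> 'I_M.+1 -> set Omega) (i : 'I_M.+1) : R :=
  fine 'E_P[fun w => (\sum_(k < N0) \1_(reach k i) w)%R]%E.

(* [f] is a probability density, on the interval of angles, of [X] conditioned
   on the event [C]; meant for [P C != 0]. *)
Definition cond_density d (Omega : measurableType d) (R : realType)
    (P : probability Omega R) (angles : interval R) (C : set Omega)
    (X : Omega -> R) (f : R -> R) : Prop :=
  [/\ measurable_fun [set` angles] f,
      forall t, t \in angles -> 0 <= f t &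
      forall B : set R, measurable B ->
        (P (C `&` X @^-1` B) / P C =
         \int[lebesgue_measure]_(t in [set` angles] `&` B) (f t)%:E)%E].

(* Main.v *)
(** Push the restriction of P to the event that one photon is transmitted
    forward by its incoming angle.  By the transmission law this measure has
    density P_T with respect to the law of the incoming angle on the event that
    the photon reaches the element, and that law has density f on the angles;
    integrating the outgoing law against it and exchanging the integrals gives
    the joint law of arrival and outgoing angle, with density
    t' |-> int_t f(t) P_T(t) rho_C(t, t').  Summing over the photons gives the
    two sides of the identity the same integral over every Borel set of angles,
    hence they agree almost everywhere. *)
Require Import Defs.
From HB Require Import structures.
From mathcomp Require Import all_boot all_order all_algebra.
From mathcomp Require Import all_classical all_reals all_analysis.
From mathcomp Require Import measurable_realfun.
Import Order.TTheory GRing.Theory Num.Theory.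
Import numFieldNormedType.Exports.
Import HBNNSimple.
Local Open Scope classical_set_scope.
Local Open Scope ring_scope.

(** * Change of variables for weighted integrals *)

(** Monotone convergence along simple approximations of [g]. The point of the formula is that its
    right side sees [mu], [D], [w] and [phi] only through the [w]-weighted mass of the preimages
    under [phi]. *)
Lemma integral_weight_comp_approx {d1 d2 : measure_display}
    {T : measurableType d1} {U : measurableType d2} {R : realType}
    (mu : {measure set T -> \bar R}) (D : set T) (w : T -> R) (phi : T -> U)
    (g : U -> \bar R) (mg : measurable_fun setT g) :
  measurable D -> measurable_fun D w -> (forall x, D x -> 0 <= w x) ->
  measurable_fun setT phi -> (forall y, 0 <= g y)%E ->
  (\int[mu]_(x in D) ((w x)%:E * g (phi x)) =
   limn (fun n => let h := nnsfun_approx measurableT mg n in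
     \sum_(y \in range h)
       (y%:E * \int[mu]_(x in D `&` phi @^-1` (h @^-1` [set y])) (w x)%:E)))%E.
Proof.
move=> mD mw w0 mphi g0.
pose h := nnsfun_approx measurableT mg.
have mhp n : measurable_fun D (h n \o phi).
  by apply: measurable_funTS; exact: measurableT_comp.
transitivity (limn (fun n => \int[mu]_(x in D) ((w x)%:E * (h n (phi x))%:E))%E).
  rewrite -monotone_convergence//.
  - apply: eq_integral => x /[!inE] xD; apply/esym/cvg_lim => //.
    by apply: cvgeZl => //; apply: cvg_nnsfun_approx.
  - move=> n; apply: emeasurable_funM; apply/measurable_EFinP => //; exact: mhp.
  - by move=> n x Dx; rewrite mule_ge0 ?lee_fin ?w0.
  - move=> x Dx a b ab /=; rewrite lee_wpmul2l ?lee_fin ?w0//.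
    exact/lefP/nd_nnsfun_approx.
congr (limn _); apply/funext => n /=; rewrite -/(h n).
have mE y : measurable (phi @^-1` (h n @^-1` [set y])).
  rewrite -[X in measurable X]setTI; apply: mphi => //.
(* The simple function is written as the finite sum of its values times the indicators of its level
   sets, so that sum and integral can be exchanged. *)
transitivity (\int[mu]_(x in D) \sum_(y \in range (h n))
    (y%:E * ((w x)%:E * (\1_(phi @^-1` (h n @^-1` [set y])) x)%:E)))%E.
  apply: eq_integral => x xD.
  rewrite (fimfunE (h n)) -fsumEFin//.
  rewrite [LHS]ge0_mule_fsumr; last by move=> y; exact: nnfun_muleindic_ge0.
  apply: eq_fsbigr => y _.
  by rewrite EFinM muleCA.
rewrite ge0_integral_fsum//.
- apply: eq_fsbigr => y; rewrite inE => -[t _ <-].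
  rewrite ge0_integralZl_EFin//.
  + congr (_ * _)%E; by rewrite [RHS]integral_mkcondr epatch_indic.
  + by move=> x Dx; rewrite mule_ge0 ?lee_fin ?w0.
  + apply: emeasurable_funM; exact/measurable_EFinP.
- move=> y; apply: emeasurable_funM => //.
  apply: emeasurable_funM; exact/measurable_EFinP.
- move=> y x Dx; rewrite muleCA mule_ge0 ?lee_fin ?w0//.
  exact: nnfun_muleindic_ge0.
Qed.

(** The hypothesis on all measurable [A] says that the two weighted measures have the same image on
    [U]; both integrals are then limits of the same sums. This one lemma serves to change the weight
    on a fixed space and to pass from [Omega] to the angles. *)
Lemma eq_integral_weight_comp {d1 d2 d3 : measure_display}
    {T1 : measurableType d1} {T2 : measurableType d2} {U : measurableType d3}
    {R : realType} {mu1 : {measure set T1 -> \bar R}}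
    {mu2 : {measure set T2 -> \bar R}} {D1 : set T1} {D2 : set T2}
    {w1 : T1 -> R} {w2 : T2 -> R} {phi1 : T1 -> U} {phi2 : T2 -> U} :
  measurable D1 -> measurable_fun D1 w1 -> (forall x, D1 x -> 0 <= w1 x) ->
  measurable_fun setT phi1 ->
  measurable D2 -> measurable_fun D2 w2 -> (forall x, D2 x -> 0 <= w2 x) ->
  measurable_fun setT phi2 ->
  (forall A, measurable A ->
    \int[mu1]_(x in D1 `&` phi1 @^-1` A) (w1 x)%:E =
    \int[mu2]_(x in D2 `&` phi2 @^-1` A) (w2 x)%:E)%E ->
  forall (E : set U) (g : U -> \bar R), measurable E -> measurable_fun E g ->
  (forall y, E y -> 0 <= g y)%E -> D1 `<=` phi1 @^-1` E ->
  D2 `<=` phi2 @^-1` E ->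
  (\int[mu1]_(x in D1) ((w1 x)%:E * g (phi1 x)) =
   \int[mu2]_(x in D2) ((w2 x)%:E * g (phi2 x)))%E.
Proof.
move=> mD1 mw1 w10 mphi1 mD2 mw2 w20 mphi2 eqw E g mE mg g0 D1E D2E.
(* [g] is controlled only on [E]. Its extension by zero is measurable and nonnegative everywhere,
   and the integrals do not change since [phi1] and [phi2] send the domains into [E]. *)
have mgE : measurable_fun setT (g \_ E) by apply/(measurable_restrictT g mE).
have gE0 y : (0 <= (g \_ E) y)%E by apply: erestrict_ge0.
transitivity (\int[mu1]_(x in D1) ((w1 x)%:E * (g \_ E) (phi1 x)))%E.
  by apply: eq_integral => x /[!inE] /D1E Ex; rewrite patchE mem_set.
transitivity (\int[mu2]_(x in D2) ((w2 x)%:E * (g \_ E) (phi2 x)))%E; last first.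
  by apply: eq_integral => x /[!inE] /D2E Ex; rewrite patchE mem_set.
rewrite !(integral_weight_comp_approx _ _ _ _ _ mgE)//.
congr (limn _); apply/funext => n /=.
by apply: eq_fsbigr => y _; rewrite eqw.
Qed.

(** * Tonelli's theorem on measurable rectangles *)

Section tonelli_on_rectangles.
Context {d1 d2 : measure_display} {T1 : measurableType d1}
  {T2 : measurableType d2} {R : realType}
  {mu1 : {sigma_finite_measure set T1 -> \bar R}}
  {mu2 : {sigma_finite_measure set T2 -> \bar R}}
  {D1 : set T1} {D2 : set T2} {f : T1 * T2 -> \bar R}.
Hypotheses (mD1 : measurable D1) (mD2 : measurable D2)
  (mf : measurable_fun (D1 `*` D2) f)
  (f0 : forall x y, D1 x -> D2 y -> (0 <= f (x, y))%E).

(** Extension by zero reduces everything to the full product: the partial integrals of [g] are those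
    of [f], themselves extended by zero. *)
Let g := f \_ (D1 `*` D2).

Let mg : measurable_fun setT g.
Proof. by apply/(measurable_restrictT f); first exact: measurableX. Qed.

Let g0 z : (0 <= g z)%E.
Proof. by apply: erestrict_ge0 => -[x y] [/= ? ?]; exact: f0. Qed.

Let restrictl x : ((fun x => \int[mu2]_(y in D2) f (x, y))%E \_ D1) x =
  (\int[mu2]_y g (x, y))%E.
Proof.
rewrite patchE; case: ifPn => xD1.
- rewrite integral_mkcond; apply: eq_integral => y _.
  by rewrite /g !patchE in_setX xD1.
- by rewrite integral0_eq// => y _; rewrite /g patchE in_setX (negbTE xD1).
Qed.

Let restrictr y : ((fun y => \int[mu1]_(x in D1) f (x, y))%E \_ D2) y =
  (\int[mu1]_x g (x, y))%E.
Proof.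
rewrite patchE; case: ifPn => yD2.
- rewrite integral_mkcond; apply: eq_integral => x _.
  by rewrite /g !patchE in_setX yD2 andbT.
- by rewrite integral0_eq// => x _; rewrite /g patchE in_setX (negbTE yD2) andbF.
Qed.

Lemma measurable_fun_integral_setXl :
  measurable_fun D1 (fun x => \int[mu2]_(y in D2) f (x, y))%E.
Proof.
apply/measurable_restrictT => //; rewrite (funext restrictl).
exact: measurable_fun_fubini_tonelli_F.
Qed.

Lemma measurable_fun_integral_setXr :
  measurable_fun D2 (fun y => \int[mu1]_(x in D1) f (x, y))%E.
Proof.
apply/measurable_restrictT => //; rewrite (funext restrictr).
exact: measurable_fun_fubini_tonelli_G.
Qed.

Lemma fubini_tonelli_setX :
  (\int[mu1]_(x in D1) \int[mu2]_(y in D2) f (x, y) =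
   \int[mu2]_(y in D2) \int[mu1]_(x in D1) f (x, y))%E.
Proof.
rewrite integral_mkcond (funext restrictl) fubini_tonelli//.
by rewrite [RHS]integral_mkcond (funext restrictr).
Qed.

End tonelli_on_rectangles.

(** * One photon crossing one element *)

Lemma measurable_weighted_transition {R : realType} {M : nat}
    {angles : interval R} {rhoS0 : R -> R} {PT : 'I_M -> R -> R -> R}
    {rhoC : 'I_M -> R -> R -> R -> R} (i : 'I_M) (a : R) (f : R -> R) :
  optical_data angles rhoS0 PT rhoC -> measurable_fun [set` angles] f ->
  measurable_fun ([set` angles] `*` [set` angles])
    (fun x : R * R => (f x.1 * PT i x.1 a * rhoC i x.1 x.2 a)%:E).
Proof.
move=> hdata mf; have mI : measurable [set` angles] by exact: measurable_itv.
apply/measurable_EFinP; apply: measurable_funM; last exact: rhoC_meas hdata i a.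
apply: (@measurable_comp _ _ _ _ _ _ [set` angles] (fun t => f t * PT i t a)
  _ fst) => //.
- by move=> _ [[x y] [? ?] <-].
- by apply: measurable_funM => //; exact: PT_meas hdata i a.
- exact: (measurable_funTS measurable_fst).
Qed.

(** Here [f] is an unnormalised density: its total mass is the probability of reaching the surface.
    No conditioning on arrival, hence no division by a possibly zero probability, occurs. *)
Lemma joint_law_outgoing {R : realType} {M : nat} {angles : interval R}
    {rhoS0 : R -> R} {PT : 'I_M -> R -> R -> R} {rhoC : 'I_M -> R -> R -> R -> R}
    {alpha : 'I_M -> R} {d : measure_display} {Omega : measurableType d}
    {P : probability Omega R} {reach : 'I_M.+1 -> set Omega}
    {theta : 'I_M.+1 -> Omega -> R} (i : 'I_M) (f : R -> R) :
  optical_data angles rhoS0 PT rhoC ->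
  photon_process P angles rhoS0 PT rhoC alpha reach theta ->
  measurable_fun [set` angles] f -> (forall t, t \in angles -> 0 <= f t) ->
  (forall B, measurable B ->
    P (reach (surf_in i) `&` theta (surf_in i) @^-1` B) =
    \int[lebesgue_measure]_(t in [set` angles] `&` B) (f t)%:E)%E ->
  forall B, measurable B ->
    (P (reach (surf_out i) `&` theta (surf_out i) @^-1` B) =
     \int[lebesgue_measure]_(t' in [set` angles] `&` B)
       \int[lebesgue_measure]_(t in [set` angles])
         (f t * PT i t (alpha i) * rhoC i t t' (alpha i))%:E)%E.
Proof.
move=> hdata hphoton mf f0 law_in B mB.
set a := alpha i; set I := [set` angles].
have mI : measurable I by exact: measurable_itv.
have mIB : measurable (I `&` B) by exact: measurableI.
have mreach := reach_meas hphoton; have mtheta := theta_meas hphoton.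
have thI j w : reach j w -> I (theta j w) by exact: (theta_angles hphoton).
have sub : reach (surf_out i) `<=` reach (surf_in i) by exact: (reach_decr hphoton).
have mPT : measurable_fun I (fun t => PT i t a) := PT_meas hdata i a.
have PT0 t : I t -> 0 <= PT i t a by move=> /(PT_itv hdata i a)/andP[].
have rC0 t t' : I t -> I t' -> 0 <= rhoC i t t' a.
  by move=> ? ?; apply: (rhoC_ge0 hdata).
have mrC : measurable_fun (I `*` (I `&` B)) (fun x : R * R => (rhoC i x.1 x.2 a)%:E).
  apply/measurable_EFinP; apply: measurable_funS (rhoC_meas hdata i a).
    exact: measurableX.
  by move=> [x y] [? []].
pose g t := (\int[lebesgue_measure]_(t' in I `&` B) (rhoC i t t' a)%:E)%E.
have mg : measurable_fun I g.
  apply: (measurable_fun_integral_setXl (mu2 := lebesgue_measure) mI mIB mrC _).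
  by move=> x y Ix [Iy _]; rewrite lee_fin rC0.
have g0 t : I t -> (0 <= g t)%E.
  by move=> It; apply: integral_ge0 => t' [It' _]; rewrite lee_fin rC0.
(* The outgoing law, applied to the sure event; the weight [1] gives the integral the shape of the
   change of variables lemma. *)
have -> : (P (reach (surf_out i) `&` theta (surf_out i) @^-1` B) =
    \int[P]_(w in reach (surf_out i)) (1%:E * g (theta (surf_in i) w)))%E.
  have /(_ setT) := @outgoing_law _ _ _ _ _ _ _ _ _ _ _ _ hphoton i _ mB.
  rewrite !setTI => ->.
    by under [RHS]eq_integral do rewrite mul1e.
  by exists setT => //; rewrite setTI preimage_setT.
have mPTth : measurable_fun (reach (surf_in i))
    (fun w => PT i (theta (surf_in i) w) a).
  apply: (measurable_comp mI _ mPT) => //; last exact: measurable_funTS.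
  by move=> _ [w rw <-]; exact: thI rw.
(* By the transmission law, restricting [P] to transmitted photons has the same effect on the
   incoming angle as weighting by [PT] the photons that arrive. *)
have -> : (\int[P]_(w in reach (surf_out i)) (1%:E * g (theta (surf_in i) w)) =
    \int[P]_(w in reach (surf_in i))
      ((PT i (theta (surf_in i) w) a)%:E * g (theta (surf_in i) w)))%E.
  apply: (eq_integral_weight_comp _ _ _ _ _ _ _ _ _ I) => //.
  - by move=> w /thI; exact: PT0.
  - move=> A mA; rewrite integral_cst ?mul1e; last first.
      by apply: measurableI => //; rewrite -[X in measurable X]setTI; exact: mtheta.
    rewrite (setIC (reach (surf_in i))) -(transmission_law hphoton); last first.
      by exists A => //; rewrite setTI.
    congr (P _); apply/seteqP; split => w /=.
      by move=> [rw Aw]; split => //; split => //; exact: sub.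
    by move=> [[? ?] ?].
  - by move=> w /sub/thI.
  - by move=> w /thI.
(* Transfer from [Omega] to the angles: the image of [P] on the arrival event under the incoming
   angle has density [f]. *)
have -> : (\int[P]_(w in reach (surf_in i))
      ((PT i (theta (surf_in i) w) a)%:E * g (theta (surf_in i) w)) =
    \int[lebesgue_measure]_(t in I) ((f t)%:E * ((PT i t a)%:E * g t)))%E.
  under eq_integral do rewrite -(mul1e (_ * _)%E).
  refine (@eq_integral_weight_comp _ _ _ _ _ _ _ P lebesgue_measure _ I (fun=> 1) f
    (theta (surf_in i)) (fun x => x) _ _ _ _ _ _ _ _ _ I
    (fun t => (PT i t a)%:E * g t)%E _ _ _ _ _) => //.
  - move=> A mA; rewrite integral_cst ?mul1e; last first.
      by apply: measurableI => //; rewrite -[X in measurable X]setTI; exact: mtheta.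
    exact: (law_in A mA).
  - by apply: emeasurable_funM => //; exact/measurable_EFinP.
  - by move=> t It; rewrite mule_ge0 ?g0// lee_fin PT0.
  - by move=> w /thI.
have mrC' t : I t -> measurable_fun (I `&` B) (fun t' => (rhoC i t t' a)%:E).
  move=> It; apply: (@measurable_comp _ _ _ _ _ _ _ _ (I `&` B) (pair t) _ _ mrC).
  - exact: measurableX.
  - by move=> _ [t' [It' Bt'] <-].
  - exact/measurable_funTS/pair1_measurable.
pose h (x : R * R) := (f x.1 * PT i x.1 a * rhoC i x.1 x.2 a)%:E.
have mh : measurable_fun (I `*` (I `&` B)) h.
  apply: measurable_funS (measurable_weighted_transition i a f hdata mf).
    exact: measurableX.
  by move=> [x y] [? []].
have h0 t t' : I t -> (I `&` B) t' -> (0 <= h (t, t'))%E.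
  by move=> It [It' _]; rewrite lee_fin mulr_ge0 ?rC0// mulr_ge0 ?f0 ?PT0.
apply: etrans (fubini_tonelli_setX (mu1 := lebesgue_measure)
  (mu2 := lebesgue_measure) mI mIB mh h0).
apply: eq_integral => t /[!inE] It /=.
rewrite muleA -EFinM -ge0_integralZl_EFin//.
- by move=> t' [It' _]; rewrite lee_fin rC0.
- exact: mrC'.
- by rewrite mulr_ge0 ?f0 ?PT0.
Qed.

(** * Expected photon numbers and conditional densities *)

Lemma photon_numberE {R : realType} {M N0 : nat} {d : measure_display}
    {Omega : measurableType d} (P : probability Omega R)
    (reach : 'I_N0 -> 'I_M.+1 -> set Omega) (i : 'I_M.+1) :
  (forall k, measurable (reach k i)) ->
  photon_number P reach i = \sum_(k < N0) fine (P (reach k i)).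
Proof.
move=> mreach; rewrite /photon_number unlock.
under eq_integral do rewrite -sumEFin.
rewrite ge0_integral_sum//; last first.
  by move=> k; apply/measurable_EFinP; exact: measurable_indic.
rewrite sum_fine => [|k _]; last exact: fin_num_measure.
by congr fine; apply: eq_bigr => k _; rewrite integral_indic// setIT.
Qed.

(* [f] is unconstrained when no photon reaches the surface: [s] is then [0]. *)
Lemma conditional_density_version {R : realType} {M N0 : nat}
    {d : measure_display} {Omega : measurableType d} {P : probability Omega R}
    {angles : interval R} {reach : 'I_N0 -> 'I_M.+1 -> set Omega}
    {theta : 'I_N0 -> 'I_M.+1 -> Omega -> R} {i : 'I_M.+1} {f : R -> R} :
  (forall k, measurable (reach k i)) ->
  (forall k, measurable_fun setT (theta k i)) ->
  (forall k, P (reach k i) != 0%E ->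
    cond_density P angles (reach k i) (theta k i) f) ->
  exists s : R -> R,
    [/\ measurable_fun [set` angles] s,
        forall t, t \in angles -> 0 <= s t,
        (\int[lebesgue_measure]_(t in [set` angles]) (s t)%:E < +oo)%E,
        forall k B, measurable B ->
          (P (reach k i `&` theta k i @^-1` B) =
           P (reach k i) *
             \int[lebesgue_measure]_(t in [set` angles] `&` B) (s t)%:E)%E &
        forall t, photon_number P reach i * f t = photon_number P reach i * s t].
Proof.
move=> mreach mtheta hf.
have null k B : measurable B -> P (reach k i) = 0%E ->
    P (reach k i `&` theta k i @^-1` B) = 0%E.
  move=> mB Pk0; apply: (subset_measure0 _ _ _ Pk0) => //.
  by apply: measurableI => //; rewrite -[X in measurable X]setTI; exact: mtheta.
(* One photon with positive arrival probability makes [f] a genuine density, of mass [1]. If there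
   is none, the expected number vanishes and [cst 0] serves. *)
have [[k0 Pk0]|none] := pselect (exists k, P (reach k i) != 0%E).
- exists f; have [mf f0 lawf] := hf k0 Pk0; split => //.
  + have := lawf setT measurableT; rewrite preimage_setT !setIT => <-.
    by rewrite divee ?ltry// fin_num_measure.
  + move=> k B mB; have [Pk|Pk] := eqVneq (P (reach k i)) 0%E.
      by rewrite Pk mul0e null.
    have [_ _ lawk] := hf k Pk.
    by rewrite -lawk// muleCA divee ?mule1// fin_num_measure.
- have P0 k : P (reach k i) = 0%E.
    by apply/eqP/negPn/negP => Pk; apply: none; exists k.
  exists (cst 0); split => //.
  + by rewrite integral0.
  + by move=> k B mB; rewrite P0 mul0e null.
  + move=> t; rewrite photon_numberE// big1 ?mul0r// => k _.
    by rewrite P0.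
Qed.

(** * Summation over the photons and almost everywhere equality *)

Theorem mainTheorem4 (R : realType) (M : nat) (hM : (1 <= M)%N)
    (angles : interval R) (rhoS0 : R -> R) (PT : 'I_M -> R -> R -> R)
    (rhoC : 'I_M -> R -> R -> R -> R)
    (hdata : optical_data angles rhoS0 PT rhoC)
    (alpha : 'I_M -> R)
    (N0 : nat) (hN0 : (0 < N0)%N)
    (d : measure_display) (Omega : measurableType d) (P : probability Omega R)
    (reach : 'I_N0 -> 'I_M.+1 -> set Omega)
    (theta : 'I_N0 -> 'I_M.+1 -> Omega -> R)
    (hphoton : forall k : 'I_N0,
       photon_process P angles rhoS0 PT rhoC alpha (reach k) (theta k))
    (hindep : independent_photons P reach theta)
    (rhoS : 'I_M.+1 -> R -> R)
    (hrhoS : forall (i : 'I_M.+1) (k : 'I_N0), P (reach k i) != 0%E ->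
       cond_density P angles (reach k i) (theta k i) (rhoS i)) :
  forall i : 'I_M,
    {ae (@lebesgue_measure R), forall t' : R, t' \in angles ->
      (photon_number P reach (surf_out i) / N0%:R * rhoS (surf_out i) t')%:E =
      (\int[lebesgue_measure]_(t in [set` angles])
         (photon_number P reach (surf_in i) / N0%:R * rhoS (surf_in i) t
          * PT i t (alpha i) * rhoC i t t' (alpha i))%:E)%E}.
Proof.
move=> i.
have mreach k := reach_meas (hphoton k).
have mtheta k := theta_meas (hphoton k).
have [s [ms s0 _ law_s Ns]] := conditional_density_version
  (mreach^~ (surf_in i)) (mtheta^~ (surf_in i)) (hrhoS (surf_in i)).
have [s' [ms' s'0 s'oo law_s' Ns']] := conditional_density_version
  (mreach^~ (surf_out i)) (mtheta^~ (surf_out i)) (hrhoS (surf_out i)).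
set I := [set` angles] in ms s0 law_s ms' s'0 s'oo law_s' *.
have mI : measurable I by exact: measurable_itv.
set a := alpha i.
pose h (x : R * R) := (s x.1 * PT i x.1 a * rhoC i x.1 x.2 a)%:E.
have mh : measurable_fun (I `*` I) h.
  by exact: (measurable_weighted_transition i a s hdata ms).
have h0 t t' : I t -> I t' -> (0 <= h (t, t'))%E.
  move=> It It'; have /andP[PT0 _] := PT_itv hdata i a It.
  by rewrite lee_fin !mulr_ge0 ?s0// (rhoC_ge0 hdata).
pose J t' := (\int[lebesgue_measure]_(t in I) h (t, t'))%E.
have mJ : measurable_fun I J.
  exact: (measurable_fun_integral_setXr (mu1 := lebesgue_measure) mI mI mh h0).
have J0 t' : I t' -> (0 <= J t')%E.
  by move=> It'; apply: integral_ge0 => t /h0; exact.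
have mh_ t' : I t' -> measurable_fun I (fun t => h (t, t')).
  move=> It'; apply: (@measurable_comp _ _ _ _ _ _ (I `*` I) h _ (pair^~ t')) => //.
  - exact: measurableX.
  - by move=> _ [t It <-].
  - exact: (measurable_funTS (pair2_measurable _)).
pose p j k := fine (P (reach k j)).
have pE j k : (p j k)%:E = P (reach k j) by rewrite fineK// fin_num_measure.
have p0 j k : 0 <= p j k by rewrite fine_ge0.
pose N := photon_number P reach.
have NE j : N j = \sum_(k < N0) p j k by rewrite /N photon_numberE.
have N_ge0 j : 0 <= N j by rewrite NE sumr_ge0.
(* The identity integrated over [B], before division by the initial number: a sum over [k] of the
   one-photon laws. *)
have balance B : measurable B ->
    ((N (surf_out i))%:E * \int[lebesgue_measure]_(t in I `&` B) (s' t)%:E =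
     (N (surf_in i))%:E * \int[lebesgue_measure]_(t in I `&` B) J t)%E.
  move=> mB; have mIB : measurable (I `&` B) by exact: measurableI.
  rewrite !NE -!sumEFin !ge0_sume_distrl => [|k _|k _]; rewrite ?lee_fin//.
  apply: eq_bigr => k _; rewrite pE -law_s'//.
  (* The arrival probability times [s] is the unnormalised density of the incoming angle of photon
     [k]. *)
  rewrite (@joint_law_outgoing _ _ _ _ _ _ _ _ _ _ _ _ i
    (fun t => p (surf_in i) k * s t) hdata (hphoton k))//.
  - rewrite -ge0_integralZl_EFin//; last 2 first.
      by move=> t' [It' _]; exact: J0.
      by apply: measurable_funS mJ.
    apply: eq_integral => t' /[!inE] -[It' _].
    rewrite -ge0_integralZl_EFin//; last 2 first.
      by move=> t It; exact: h0.
      exact: mh_.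
    by apply: eq_integral => t _; rewrite -EFinM !mulrA.
  - exact: measurable_funM.
  - by move=> t It; rewrite mulr_ge0// s0.
  - move=> A mA; rewrite law_s// -pE -ge0_integralZl_EFin//.
    + exact: measurableI.
    + by move=> t [It _]; rewrite lee_fin s0.
    + by apply/measurable_EFinP; apply: measurable_funS ms.
have N0_ge0 : 0 <= (N0%:R : R)^-1 by rewrite invr_ge0.
have aeE : ae_eq lebesgue_measure I
    (fun t' => (N (surf_out i) / N0%:R)%:E * (s' t')%:E)%E
    (fun t' => (N (surf_in i) / N0%:R)%:E * J t')%E.
  (* Equal integrals over every measurable subset of the angles; integrability of the left side
     comes from the finite mass of [s']. *)
  apply: integral_ae_eq => //.
  - apply: integrableZl => //; apply/integrableP; split.
      exact/measurable_EFinP.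
    under eq_integral => t /[!inE] It do rewrite gee0_abs ?lee_fin ?s'0//.
    exact: s'oo.
  - by apply: emeasurable_funM.
  - move=> E EI mE; rewrite -[in LHS](setIidr EI) -[in RHS](setIidr EI).
    have mIE : measurable (I `&` E) by exact: measurableI.
    rewrite !ge0_integralZl_EFin ?mulr_ge0//.
    + by rewrite !(mulrC _ N0%:R^-1) !EFinM -!muleA balance.
    + by move=> t [/J0].
    + by apply: measurable_funS mJ.
    + by move=> t [It _]; rewrite lee_fin s'0.
    + by apply/measurable_EFinP; apply: measurable_funS ms'.
apply: filterS aeE => t' aeE It'.
(* Return from [s'] and [s] to [rhoS]: once multiplied by the photon number they agree at every
   point, also where that number is zero. *)
rewrite mulrAC Ns' mulrAC EFinM (aeE It') -ge0_integralZl_EFin//.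
- apply: eq_integral => t _.
  rewrite -EFinM; congr (_%:E); rewrite !mulrA; congr (_ * _ * _).
  by rewrite mulrAC -Ns mulrAC.
- by move=> t It; exact: h0.
- exact: mh_.
- by rewrite mulr_ge0.
Qed.
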